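(* If $f=\alpha_0u_0+\alpha_1u_1+\alpha_2u_0u_1$ with $\alpha_0,\alpha_1,\alpha_2\in\mathbb{R}$ such that $$\alpha_0>\alpha_1+\alpha_2\quad\text{and}\quad\alpha_1=\alpha_2>0,$$ then $$\mathsf{L}_{\mathsf{d}_{\mathcal{C}}}(f)=\max\{2(\alpha_0+\alpha_1),\ 8\alpha_1\}$$ and $$\mathsf{L}^{\lambda}_{\mathcal{T}_{\mathcal{C}}}(f)=2(\alpha_0+2\alpha_1)=2(\alpha_0+2\alpha_2),$$ and $\mathsf{L}_{\mathsf{d}_{\mathcal{C}}}(f)<\mathsf{L}^{\lambda}_{\mathcal{T}_{\mathcal{C}}}(f)$. In particular, $\mathsf{L}_{\mathsf{d}_{\mathcal{C}}}(4u_0+u_1+u_0u_1)=10<12=\mathsf{L}^{\lambda}_{\mathcal{T}_{\mathcal{C}}}(4u_0+u_1+u_0u_1)$.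
   Context: Convention: $\mathbb{N}$ contains $0$. The Cantor space is $\mathcal{C}=\{(x_n)_{n\in\mathbb{N}} : x_n\in\{0,1\} \text{ for all } n\}$ with the metric $\mathsf{d}_{\mathcal{C}}(x,y)=0$ if $x=y$ and $\mathsf{d}_{\mathcal{C}}(x,y)=2^{-\min\{m\in\mathbb{N} : x_m\neq y_m\}}$ otherwise. $C(\mathcal{C})$ is the C*-algebra of continuous functions $\mathcal{C}\to\mathbb{C}$ with pointwise operations, supremum norm $\|\cdot\|_\infty$ and unit $1_{C(\mathcal{C})}$ (the constant function $1$). For $n\in\mathbb{N}$, $\eta_n\in C(\mathcal{C})$ is the coordinate map $\eta_n((z_m)_{m\in\mathbb{N}})=z_n$, and $u_n=2\eta_n-1_{C(\mathcal{C})}$ (so $u_n$ takes values in $\{-1,1\}$). Set $B_0=\emptyset$ and, for $n\geq 1$, $B_n=\{\prod_{j\in F}u_j : \emptyset\neq F\subseteq\{0,\ldots,n-1\}\}$. For $n \in \mathbb{N}$ set $B_n'=\{1_{C(\mathcal{C})}\}\cup B_n$ and $A_n=\operatorname{span}_{\mathbb{C}} B_n'$. $\lambda$ is the state on $C(\mathcal{C})$ (unital norm-one continuous linear functional) determined by $\lambda\left(\prod_{j\in F}u_j\right)=0$ for every nonempty finite $F\subset\mathbb{N}$; it is integration against the product of the uniform probability measures on $\{0,1\}$. For $n\in\mathbb{N}$, $E_n:C(\mathcal{C})\to A_n$ is $E_n(f)=\sum_{a\in B_n'}\lambda(fa)\,a$. The two seminorms (with values in $[0,\infty]$) are, for $f\in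 C(\mathcal{C})$, $$\mathsf{L}_{\mathsf{d}_{\mathcal{C}}}(f)=\sup_{x,y\in\mathcal{C},\,x\neq y}\frac{|f(x)-f(y)|}{\mathsf{d}_{\mathcal{C}}(x,y)},\qquad \mathsf{L}^{\lambda}_{\mathcal{T}_{\mathcal{C}}}(f)=\sup_{n\in\mathbb{N}}\frac{\|f-E_n(f)\|_\infty}{2^{-(n+1)}}.$$ *)

(* Defs.v *)
From HB Require Import structures.
From mathcomp Require Import all_boot all_order all_algebra.
From mathcomp Require Import finmap complex.
From mathcomp Require Import all_classical all_reals all_analysis.
From mathcomp Require Import ring.

Set Implicit Arguments.
Unset Strict Implicit.
Unset Printing Implicit Defensive.

Import Order.TTheory GRing.Theory Num.Theory.
Import numFieldNormedType.Exports.

Local Open Scope classical_set_scope.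
Local Open Scope ring_scope.

(* The library gives [continuousType X K^o] no algebraic structure: it is
   inherited here from the pointwise operations on [X -> K^o]. *)
Section continuous_algebra.
Context {X : ptopologicalType} {K : numFieldType}.
Local Notation T := (continuousType X K^o).

Definition continuous_pred : {pred X -> K^o} :=
  mem [set f : X -> K^o | continuous f].

Section Sub.
Context (f : X -> K^o) (fP : f \in continuous_pred).
Definition continuous_Sub : T := mkcts (set_mem fP).
End Sub.

Lemma continuous_rect (P : T -> Type) :
  (forall f (fP : f \in continuous_pred), P (continuous_Sub fP)) ->
  forall u : T, P u.
Proof.
move=> PS f; have fP : (f : X -> K^o) \in continuous_pred.
  by rewrite inE; exact: cts_fun.
by rewrite (_ : f = continuous_Sub fP)//; exact/continuousEP.
Qed.

Lemma continuous_SubK f (fP : f \in continuous_pred) :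
  continuous_Sub fP = f :> (X -> K^o).
Proof. by []. Qed.

HB.instance Definition _ := isSub.Build _ _ T continuous_rect continuous_SubK.

Lemma continuous_subring_closed : subring_closed continuous_pred.
Proof.
split=> [|f g|f g]; rewrite !inE/=.
- by move=> x; exact: cvg_cst.
- by move=> cf cg x; apply: (@continuousB K K^o); [exact: cf|exact: cg].
- by move=> cf cg x; apply: continuousM; [exact: cf|exact: cg].
Qed.

Lemma continuous_submod_closed : submod_closed continuous_pred.
Proof.
split=> [|a f g]; rewrite !inE/=.
- by move=> x; exact: cvg_cst.
- move=> cf cg x; apply: (@continuousD K K^o); last exact: cg.
  by apply: continuousZr; exact: cf.
Qed.

HB.instance Definition _ :=
  GRing.isSubringClosed.Build _ continuous_pred continuous_subring_closed.
HB.instance Definition _ :=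
  GRing.isSubmodClosed.Build _ _ continuous_pred continuous_submod_closed.
HB.instance Definition _ := [SubChoice_isSubComNzRing of T by <:].
HB.instance Definition _ := [SubZmodule_isSubLmodule of T by <:].

End continuous_algebra.

Local Open Scope complex_scope.

Notation normc := ComplexField.Normc.normc.

(* C(C), complex-valued continuous functions on the Cantor space; the library's
   product topology on [cantor_space] is the one induced by [cantor_dist]. *)
Notation CC R := (continuousType cantor_space R[i]^o).

Section cantor_dist.
Context (R : realType).

Definition cantor_dist (x y : cantor_space) : R :=
  if pselect (exists m, x m != y m) is left xy then 2 ^- ex_minn xy else 0.

End cantor_dist.

Section cantor_algebra.
Context (R : realType).
Implicit Types (f : CC R) (n : nat).

(* The set is nonempty and bounded ([has_sup_normc]), so this real supremum is
   genuine. *)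
Definition supnorm f : R := sup (range (fun x => normc (f x))).

Lemma has_sup_normc f : has_sup (range (fun x => normc (f x))).
Proof.
have cf : continuous (fun x => normc (f x) : R).
  move=> x; apply/cvgrPdist_lt => e e0.
  have /cvgrPdist_lt/(_ e%:C) := @cts_fun _ _ f x.
  rewrite ltcR => /(_ e0); apply: filterS => y.
  rewrite normc_def ltcR; apply: le_lt_trans.
  rewrite (_ : Num.sqrt _ = normc (f x - f y)); last by case: (_ - _).
  exact: (@ler_dist_dist R (Rcomplex R) (f x) (f y)).
split; first by exists (normc (f point)); exists point.
have [M [_ fM]] : bounded_set (range (fun x => normc (f x) : R)).
  apply: compact_bounded; apply: continuous_compact cantor_space_compact.
  exact: continuous_subspaceT.
exists (M + 1) => r fr; apply: le_trans (ler_norm r) _.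
by apply: fM fr; rewrite ltrDl ltr01.
Qed.

Lemma coordinate_continuous n :
  continuous (fun z : cantor_space => (z n)%:R : R[i]^o).
Proof.
move=> z; apply: (@cvg_comp _ _ _ (fun z : cantor_space => z n)
  (fun b : bool => b%:R : R[i]^o) _ (nbhs (z n))).
  exact: (@proj_continuous nat (fun=> bool) n z).
move=> S /nbhs_singleton Sz.
by apply: (filterS _ (discrete_set1 (z n))) => _ ->.
Qed.

Definition eta_ n : CC R := mkcts (coordinate_continuous (n := n)).

Definition u_ n : CC R := 2 *: eta_ n - 1.

Definition B_ n : set (CC R) :=
  [set \prod_(j <- F) u_ j | F in
    [set F : {fset nat} | F != fset0 /\ forall j, j \in F -> (j < n)%N]].

Definition B'_ n : set (CC R) := 1 |` B_ n.

Lemma finite_B'_ n : finite_set (B'_ n).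
Proof.
rewrite finite_setU; split; first exact: finite_set1.
apply: (@sub_finite_set _ _ ((fun F : {fset nat} => \prod_(j <- F) u_ j) @`
  [set` fpowerset [fset j in iota 0 n]%fset])).
  move=> _ [F [_ Fn] <-]; exists F => //=; rewrite fpowersetE.
  by apply/fsubsetP => j /Fn jn; rewrite !inE mem_iota.
exact/finite_image/finite_fset.
Qed.

Definition A_ n : set (CC R) :=
  [set \sum_(a \in B'_ n) c a *: a | c in [set: CC R -> R[i]]].

Definition opnorm (lam : {scalar CC R}) : \bar R :=
  ereal_sup [set (normc (lam f))%:E | f in [set f | supnorm f <= 1]].

Definition is_state (lam : {scalar CC R}) :=
  lam 1 = 1 /\ opnorm lam = 1%E.

(* The conditions characterizing the state [lambda] of C(C). *)
Definition is_product_state (lam : {scalar CC R}) :=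
  is_state lam /\
  forall F : {fset nat}, F != fset0 -> lam (\prod_(j <- F) u_ j) = 0.

Definition E_ (lam : {scalar CC R}) n f : CC R :=
  \sum_(a \in B'_ n) lam (f * a) *: a.

Lemma E_in_A_ (lam : {scalar CC R}) n f : A_ n (E_ lam n f).
Proof. by exists (fun a => lam (f * a)). Qed.

Definition Lip f : \bar R :=
  ereal_sup [set (normc (f xy.1 - f xy.2) / cantor_dist R xy.1 xy.2)%:E |
    xy in [set xy : cantor_space * cantor_space | xy.1 <> xy.2]].

Definition Ltree (lam : {scalar CC R}) f : \bar R :=
  ereal_sup (range (fun n => (supnorm (f - E_ lam n f) / 2 ^- n.+1)%:E)).

End cantor_algebra.

(* Existence of [lambda], as an ultrafilter limit of finite averages. *)
Section product_state.
Context (R : realType).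
Implicit Types (g : cantor_space -> R[i]) (n : nat).

Definition upd n (b : bool) (x : cantor_space) : cantor_space :=
  fun m => if m == n then b else x m.
Definition avg n g : cantor_space -> R[i] :=
  fun x => (g (upd n false x) + g (upd n true x)) / 2.
Fixpoint mean n g : R[i] := if n is m.+1 then mean m (avg m g) else g point.

Lemma meanP n a f g : mean n (fun x => a * f x + g x) = a * mean n f + mean n g.
Proof.
elim: n f g => [//|n IH] f g /=; rewrite -IH; congr mean.
by apply/funext => x; rewrite /avg; field.
Qed.

Lemma mean_bound n M g : (forall x, normc (g x) <= M) -> normc (mean n g) <= M.
Proof.
elim: n g => [g gM|n IH g gM] /=; first exact: gM.
apply: IH => x; rewrite /avg.
rewrite ComplexField.Normc.normcM ComplexField.Normc.normcV.
have -> : normc (2 : R[i]) = 2.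
  rewrite -[2 in LHS](rmorph_nat (real_complex R)) /= expr0n addr0 sqrtr_sqr.
  by rewrite ger0_norm.
rewrite ler_pdivrMr//; apply: le_trans (le_normcD _ _) _.
by rewrite mulr_natr mulr2n lerD.
Qed.

Lemma mean1 n : mean n (fun=> 1) = 1.
Proof.
elim: n => [//|n IH] /=; rewrite -[RHS]IH; congr mean.
by apply/funext => x; rewrite /avg; field.
Qed.

Lemma mean0 n : mean n (fun=> 0) = 0.
Proof.
elim: n => [//|n IH] /=; rewrite -[RHS]IH; congr mean.
by apply/funext => x; rewrite /avg; field.
Qed.

Definition sign_of (b : bool) : R[i] := 2 * b%:R - 1.

Lemma mean_prod n (F : {fset nat}) j : j \in F -> (j < n)%N ->
  mean n (fun x => \prod_(k <- F) sign_of (x k)) = 0.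
Proof.
move=> jF; elim: n => [//|n IH] jn /=.
case: (boolP (n \in F)) => nF.
  rewrite -[RHS](mean0 n); congr mean; apply/funext => x; rewrite /avg.
  rewrite !(big_fsetD1 n nF) /=.
  have -> : \prod_(i <- (F `\ n)%fset) sign_of (upd n false x i) =
            \prod_(i <- (F `\ n)%fset) sign_of (upd n true x i).
    rewrite big_seq [RHS]big_seq; apply: eq_bigr => i.
    by rewrite !inE /upd => /andP[/negPf->].
  have [-> ->] : upd n false x n = false /\ upd n true x n = true.
    by rewrite /upd eqxx.
  rewrite /sign_of /= ?mulr0n ?mulr1n; set q := \prod_(_ <- _) _; by field.
rewrite -[RHS]IH; last first.
  rewrite ltnS leq_eqVlt in jn; case/orP: jn => // /eqP e.
  by rewrite e (negPf nF) in jF.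
congr mean; apply/funext => x; rewrite /avg.
rewrite (_ : \prod_(k <- F) sign_of (upd n false x k) =
  \prod_(k <- F) sign_of (x k)).
  rewrite (_ : \prod_(k <- F) sign_of (upd n true x k) =
    \prod_(k <- F) sign_of (x k)).
    by field.
  rewrite big_seq [RHS]big_seq; apply: eq_bigr => i iF; rewrite /upd.
  by case: eqP => // e; rewrite e (negPf nF) in iF.
rewrite big_seq [RHS]big_seq; apply: eq_bigr => i iF; rewrite /upd.
by case: eqP => // e; rewrite e (negPf nF) in iF.
Qed.

Lemma exists_product_state : exists lam : {scalar CC R}, is_product_state lam.
Proof.
have [U [UU sU]] := ultraFilterLemma (eventually_filter).
have cvU (s : nat -> R) M : (forall n, `|s n| <= M) -> cvg (s @ U).
  move=> sM; have := @segment_compact R (- M) M.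
  rewrite compact_ultra => /(_ (s @ U)).
  have sUU : UltraFilter (s @ U).
    split; first exact: fmap_proper_filter.
    move=> G GF sG; rewrite predeqE => A; split; last exact: sG.
    move=> GA; case: (in_ultra_setVsetC (s @^-1` A) UU) => // h.
    have GnA := sG (~` A) h.
    by have [? []] := filter_ex (filterI GA GnA).
  have sI : (s @ U) `[- M, M]%classic.
    apply: (@filterS _ U _ setT); [|exact: filterT] => n _.
    by rewrite /= in_itv /= -ler_norml; exact: sM.
  by move=> /(_ sUU sI)[l [_ sl]]; apply/cvg_ex; exists l.
have supB (f : CC R) x : normc (f x) <= supnorm f.
  apply: sup_upper_bound; [exact: has_sup_normc|by exists x].
pose r (f : CC R) n := complex.Re (mean n f).
pose i (f : CC R) n := complex.Im (mean n f).
have absri (z : R[i]) :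
    (`|complex.Re z| <= normc z) /\ (`|complex.Im z| <= normc z).
  case: z => a b /=; split; rewrite -sqrtr_sqr ler_wsqrtr//.
    by rewrite lerDl sqr_ge0.
  by rewrite lerDr sqr_ge0.
have cr f : cvg (r f @ U).
  apply: (cvU _ (supnorm f)) => n; apply: le_trans (absri _).1 _.
  exact: mean_bound.
have ci f : cvg (i f @ U).
  apply: (cvU _ (supnorm f)) => n; apply: le_trans (absri _).2 _.
  exact: mean_bound.
pose lam (f : CC R) : R[i]^o := lim (r f @ U) +i* lim (i f @ U).
have lamE f a b : r f @ U --> a -> i f @ U --> b -> lam f = a +i* b.
  by move=> ra ib; rewrite /lam (cvg_lim _ ra)// (cvg_lim _ ib).
have lamL : linear_for *%R lam.
  move=> a f g.
  have meq n : mean n (a *: f + g : CC R) = a * mean n f + mean n g.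
    by rewrite -meanP.
  rewrite (lamE _
    (complex.Re a * lim (r f @ U) - complex.Im a * lim (i f @ U) +
      lim (r g @ U))
    (complex.Re a * lim (i f @ U) + complex.Im a * lim (r f @ U) +
      lim (i g @ U))).
  - by rewrite /lam; case: a {meq}.
  - have -> : r (a *: f + g) =
        (fun n => complex.Re a * r f n - complex.Im a * i f n + r g n).
      apply/funext => n; rewrite /r /i meq.
      by case: a {meq} (mean n f) (mean n g) => ? ? [? ?] [? ?].
    apply: cvgD; last exact: cr.
    by apply: cvgB; apply: cvgMr; [exact: cr|exact: ci].
  - have -> : i (a *: f + g) =
        (fun n => complex.Re a * i f n + complex.Im a * r f n + i g n).
      apply/funext => n; rewrite /r /i meq.
      by case: a {meq} (mean n f) (mean n g) => ? ? [? ?] [? ?].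
    apply: cvgD; last exact: ci.
    by apply: cvgD; apply: cvgMr; [exact: ci|exact: cr].
pose lamM := GRing.isLinear.Build _ _ _ _ lam lamL.
pose L : {scalar CC R} := HB.pack lam lamM.
have L1 : L 1 = 1.
  rewrite /L /=; apply: lamE.
    rewrite (_ : r 1 = cst 1); first exact: cvg_cst.
    by apply/funext => n; rewrite /r (mean1 n).
  rewrite (_ : i 1 = cst 0); first exact: cvg_cst.
  by apply/funext => n; rewrite /i (mean1 n).
have Lb f : normc (L f) <= supnorm f.
  have s0 : 0 <= supnorm f.
    apply: le_trans (supB f point).
    by case: (f point) => ? ?; exact: sqrtr_ge0.
  rewrite /L /= -(ler_sqr _ s0)//; last exact: sqrtr_ge0.
  rewrite sqr_sqrtr ?addr_ge0 ?sqr_ge0//.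
  have : (fun n => r f n * r f n + i f n * i f n) @ U -->
      lim (r f @ U) * lim (r f @ U) + lim (i f @ U) * lim (i f @ U).
    apply: cvgD; first by apply: cvgM; exact: cr.
    by apply: cvgM; exact: ci.
  move=> c; rewrite !expr2 -(cvg_lim _ c)//; apply: limr_le.
    by apply/cvg_ex; eexists; exact: c.
  apply: filterS filterT => n _.
  have := mean_bound n (supB f); rewrite /r /i.
  case: (mean n f) => a b /= h; rewrite -!expr2.
  rewrite -(@sqr_sqrtr _ (a ^+ 2 + b ^+ 2)) ?addr_ge0 ?sqr_ge0//.
  by rewrite ler_sqr// nnegrE sqrtr_ge0.
exists L; split; first split => //.
  apply/eqP; rewrite eq_le; apply/andP; split.
    apply: ub_ereal_sup => _ [f f1 <-].
    by rewrite lee_fin; exact: le_trans (Lb f) f1.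
  apply: ereal_sup_ubound; exists 1; last first.
    by rewrite L1 ComplexField.Normc.normc1.
  apply: ge_sup; first by exists (normc 1); exists point.
  by move=> _ [x _ <-]; rewrite ComplexField.Normc.normc1.
move=> F /fset0Pn[j jF].
have mF n : (j < n)%N -> mean n (\prod_(k <- F) u_ R k : CC R) = 0.
  move=> jn; rewrite -(mean_prod jF jn); congr mean; apply/funext => x.
  elim/big_rec2: _ => [//|k y1 y2 _ <-]; by [].
apply: lamE; apply: cvg_near_cst; apply: sU; exists j.+1 => // n /= jn.
  by rewrite /r mF.
by rewrite /i mF.
Qed.

End product_state.

(* Main.v *)
(* By the orthogonality of the Walsh functions [\prod_(j in F) u_j] for [lam],
   [E_n] fixes those with F contained in {0, ..., n-1} and kills the others.
   Hence E_0 f = 0, E_1 f = a0 u0 and E_n f = f for n >= 2, so that the tree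
   seminorm is the larger of 2 ||f|| = 2 (a0 + 2 a1) and
   4 ||f - a0 u0|| = 8 a1, which is the former since a0 > 2 a1.  The function f
   takes the values a0 + 2 a1 and a0 - 2 a1 on the two cylinders x_0 = 1 and is
   constantly - a0 on x_0 = 0; comparing points at distance 1 and 1/2 gives the
   Lipschitz seminorm. *)
Require Import Defs.
From HB Require Import structures.
From mathcomp Require Import all_boot all_order all_algebra.
From mathcomp Require Import finmap complex.
From mathcomp Require Import all_classical all_reals all_analysis.
From mathcomp Require Import lra.

Set Implicit Arguments.
Unset Strict Implicit.
Unset Printing Implicit Defensive.

Import Order.TTheory GRing.Theory Num.Theory.
Import numFieldNormedType.Exports.

Local Open Scope classical_set_scope.
Local Open Scope ring_scope.
Local Open Scope complex_scope.

(** * Walsh functions: products of the [u_ R j] over finite index sets *)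

Section walsh.
Context (R : realType).
Implicit Types (f : CC R) (F G : {fset nat}).

Definition walsh F : CC R := \prod_(j <- F) u_ R j.

Lemma u_E n (x : cantor_space) : u_ R n x = (if x n then 1 else - 1 : R)%:C.
Proof.
have -> : u_ R n x = 2 * (x n)%:R - 1 by [].
case: (x n) => /=; rewrite ?mulr0 ?sub0r ?rmorphN rmorph1 //.
by rewrite mulr1 -(natrB _ (leqnSn 1)).
Qed.

Lemma u_sqr n : u_ R n * u_ R n = 1.
Proof.
apply/continuousEP => x.
change (u_ R n x * u_ R n x = 1); rewrite u_E -rmorphM /=.
by case: (x n); rewrite ?mulrNN mulr1.
Qed.

(* [CC R] carries no algebra structure, so [scalerAl] does not apply. *)
Lemma scaleMl (c : R[i]) f g : (c *: f) * g = c *: (f * g).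
Proof.
apply/continuousEP => x.
by change ((c * f x) * g x = c * (f x * g x)); rewrite mulrA.
Qed.

Lemma walsh0 : walsh fset0 = 1.
Proof. exact: big_seq_fset0. Qed.

Lemma walsh1 n : walsh [fset n]%fset = u_ R n.
Proof. exact: big_seq_fset1. Qed.

Lemma walsh2 m n : m != n -> walsh [fset m; n]%fset = u_ R m * u_ R n.
Proof. by move=> mn; rewrite /walsh big_fsetU1 ?inE// big_seq_fset1. Qed.

Lemma walsh_sqr F : walsh F * walsh F = 1.
Proof. by rewrite -big_split big1 //= => n _; exact: u_sqr. Qed.

Lemma walshU F G : [disjoint F & G]%fset ->
  walsh (F `|` G)%fset = walsh F * walsh G.
Proof.
move=> FG.
pose P j := j \in F.
rewrite /walsh (big_fsetID _ P) /=.
congr (_ * _); apply: eq_fbigl => j; rewrite !inE /P.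
  by case: (j \in F); rewrite ?andbF.
have [jF|_] := boolP (j \in F); rewrite ?andbF ?andbT //.
by rewrite (negPf (fdisjointP FG _ jF)).
Qed.

(** Each [u_ R j] squares to 1, so the factors indexed by the intersection cancel and the symmetric
    difference remains. *)
Lemma walshM F G :
  walsh F * walsh G = walsh ((F `\` G) `|` (G `\` F))%fset.
Proof.
have dec A B : walsh A = walsh (A `\` B)%fset * walsh (A `&` B)%fset.
  rewrite -walshU; last first.
    by apply/fdisjointP => j; rewrite !inE => /andP[/negPf->]; rewrite andbF.
  by rewrite fsetUC fsetID.
rewrite (dec F G) (dec G F) (fsetIC G F) mulrACA walsh_sqr mulr1 walshU//.
apply/fdisjointP => j; rewrite !inE => /andP[/negPf-> ->//].
Qed.

(** The adjoined constant 1 is the Walsh function of the empty set. *)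
Lemma B'_walsh n f :
  B'_ n f <->
  exists2 F : {fset nat}, (forall j, j \in F -> (j < n)%N) & f = walsh F.
Proof.
split=> [[->|[F [_ Fn] <-]]|[F Fn ->]].
- by exists fset0; rewrite ?walsh0.
- by exists F.
- have [->|F0] := eqVneq F fset0; first by left; rewrite walsh0.
  by right; exists F.
Qed.

(** * Orthonormality under the state, and the maps [E_] *)

Section state.
Context (lam : {scalar CC R}) (hlam : is_product_state lam).

(** For distinct [F] and [G] the symmetric difference is nonempty, so the state kills the
    product. *)
Lemma state_walshM F G : lam (walsh F * walsh G) = (F == G)%:R.
Proof.
have [[l1 _] l0] := hlam.
have [->|FG] := eqVneq F G; first by rewrite walsh_sqr.
rewrite walshM l0//; apply: contraNneq FG => /eqP.
by rewrite fsetU_eq0 !fsetD_eq0 eqEfsubset.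
Qed.

(** [E_] sums over a set of functions; injectivity allows passing back to index sets. Were two
    distinct sets to give the same function, orthonormality would yield 1 = 0. *)
Lemma walsh_inj : injective walsh.
Proof.
move=> F G FG; apply/eqP; have := state_walshM F G.
rewrite FG walsh_sqr (hlam.1.1); case: eqP => // _ /eqP.
by rewrite oner_eq0.
Qed.

Lemma E_linear n (c : R[i]) f g :
  E_ lam n (c *: f + g) = c *: E_ lam n f + E_ lam n g.
Proof.
rewrite /E_ !fsbig_finite; do ?exact: finite_B'_.
rewrite /= scaler_sumr -big_split /=.
apply: eq_bigr => a _; rewrite mulrDl scaleMl linearP /=.
by rewrite scalerDl scalerA.
Qed.

Lemma E_walsh n F :
  E_ lam n (walsh F) = if all (ltn^~ n) F then walsh F else 0.
Proof.
rewrite /E_.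
(* By orthogonality, only the term at [walsh F] itself can survive, if it occurs in the sum. *)
have E0 a : B'_ n a -> a <> walsh F -> lam (walsh F * a) *: a = 0.
  move=> /B'_walsh[G _ ->] aF; rewrite state_walshM.
  by case: eqP aF => [->//|_ _]; rewrite scale0r.
case: ifPn => [/allP Fn|nF].
  rewrite (fsbigD1 (walsh F)); [|exact: finite_B'_|].
    2: by apply/B'_walsh; exists F.
  rewrite state_walshM eqxx scale1r fsbig1 /= ?addr0// => a [/= Ba aF].
  exact: E0.
rewrite fsbig1// => a Ba; apply: E0 => // aF; case/negP: nF.
move: Ba => /B'_walsh[G Gn]; rewrite aF => /walsh_inj ->.
exact/allP.
Qed.

End state.

Lemma supnorm_eq f M x : (forall y, normc (f y) <= M) -> normc (f x) = M ->
  supnorm f = M.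
Proof.
move=> fM fx; apply/eqP; rewrite eq_le; apply/andP; split.
  by apply: ge_sup; [exists (normc (f x)); exists x|move=> _ [y _ <-]].
by rewrite -fx; apply: sup_upper_bound; [exact: has_sup_normc|exists x].
Qed.

Lemma normc_real (r : R) : normc r%:C = `|r|.
Proof. by rewrite /= expr0n addr0 sqrtr_sqr. Qed.

Lemma cantor_dist_first_diff (x y : cantor_space) n : x n != y n ->
  (forall m, (m < n)%N -> x m = y m) -> cantor_dist R x y = 2 ^- n.
Proof.
move=> xyn eqxy; rewrite /cantor_dist; case: pselect => [xy|]; last first.
  by case; exists n.
case: ex_minnP => m xym mmin; congr (2 ^- _).
apply/eqP; rewrite eqn_leq mmin// leqNgt.
by apply: contraNN xym => /eqxy ->.
Qed.

End walsh.

(** * The two seminorms of the given function *)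

Section two_level.
Context (R : realType) (a0 a1 : R) (f : CC R)
  (fE : f = a0%:C *: u_ R 0 + a1%:C *: u_ R 1 + a1%:C *: (u_ R 0 * u_ R 1)).

Lemma two_levelE (x : cantor_space) :
  f x = (if x 0%N then a0 + (if x 1%N then 2 * a1 else - (2 * a1)) else - a0)%:C.
Proof.
rewrite fE.
change (a0%:C * u_ R 0 x + a1%:C * u_ R 1 x + a1%:C * (u_ R 0 x * u_ R 1 x) =
 (if x 0%N then a0 + (if x 1%N then 2 * a1 else - (2 * a1)) else - a0)%:C).
rewrite !u_E -!rmorphM -!rmorphD /=; congr (_%:C).
by case: (x 0%N); case: (x 1%N); lra.
Qed.

Lemma Lip_two_level : a1 + a1 < a0 -> 0 < a1 ->
  Lip f = (Num.max (2 * (a0 + a1)) (8 * a1))%:E.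
Proof.
move=> a01 a1_gt0.
apply/eqP; rewrite eq_le; apply/andP; split.
  apply: ge_ereal_sup => _ [[x y] /= xy <-]; rewrite lee_fin le_max.
  rewrite !two_levelE -rmorphB normc_real.
  (* Points that differ at coordinate 0 are at distance 1, and their values differ by 2 a0 + 2 a1 or
     2 a0 - 2 a1 in absolute value. *)
  have [x0|x0] := boolP (x 0%N == y 0%N); last first.
    apply/orP; left; rewrite (@cantor_dist_first_diff _ _ _ 0%N)//.
    rewrite expr0 invr1 divr1 ler_norml; apply/andP.
    by move: x0; case: (x 0%N); case: (y 0%N) => // _;
      case: (x 1%N); case: (y 1%N); split; lra.
  apply/orP; right; rewrite -(eqP x0).
  (* [f] depends only on the first two coordinates, so a later first difference contributes 0. A
     first difference at coordinate 1 means distance 1/2 and a gap of at most 4 a1. *)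
  have [->|x1] := eqVneq (x 1%N) (y 1%N).
    by rewrite subrr normr0 mul0r; lra.
  rewrite (@cantor_dist_first_diff _ _ _ 1%N)//; last by case=> // _; exact/eqP.
  rewrite expr1 invrK -ler_pdivlMr// ler_norml; apply/andP.
  by move: x1; case: (x 0%N); case: (x 1%N); case: (y 1%N) => // _; split; lra.
(* Pairs of such points attain both bounds: changing [b] gives the quotient 2 (a0 + a1), changing
   [c] with [b] true gives 8 a1. *)
pose p b c : cantor_space := fun n => if n is 0%N then b else c.
have lb x y n : x n != y n -> (forall m, (m < n)%N -> x m = y m) ->
    ((normc (f x - f y) * 2 ^+ n)%:E <= Lip f)%E.
  move=> xyn eqxy; apply: ereal_sup_ubound; exists (x, y) => /=.
    by move=> xy; rewrite xy eqxx in xyn.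
  by rewrite (cantor_dist_first_diff _ xyn eqxy) invrK.
rewrite EFin_max ge_max; apply/andP; split.
  apply: le_trans (lb (p true true) (p false true) 0%N isT _) => //.
  rewrite !two_levelE -rmorphB normc_real lee_fin /= expr0 mulr1.
  by apply: le_trans (ler_norm _); lra.
apply: le_trans (lb (p true true) (p true false) 1%N isT _); last by case.
rewrite !two_levelE -rmorphB normc_real lee_fin /= expr1.
by rewrite -ler_pdivrMr//; apply: le_trans (ler_norm _); lra.
Qed.

Lemma Ltree_two_level (lam : {scalar CC R}) : is_product_state lam ->
  a1 + a1 < a0 -> 0 < a1 ->
  Ltree lam f = (2 * (a0 + 2 * a1))%:E.
Proof.
move=> hlam a01 a1_gt0.
have EE n : E_ lam n f = if n is m.+1 then if m is _.+1 then f else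
    a0%:C *: u_ R 0 else 0.
  (* Nested with a final 0, every layer has the shape [c *: f + g] to which [E_linear] applies. *)
  have fE' : f = a0%:C *: walsh R [fset 0%N]%fset +
      (a1%:C *: walsh R [fset 1%N]%fset +
        (a1%:C *: walsh R [fset 0%N; 1%N]%fset + 0)).
    by rewrite !walsh1 walsh2// addr0 addrA.
  have E0 : E_ lam n 0 = 0.
    have := E_linear lam n (-1) 0 0.
    by rewrite scaler0 addr0 scaleN1r addNr.
  rewrite {1}fE' !(E_linear, E_walsh hlam) E0.
  have all1 i : all (ltn^~ n) [fset i]%fset = (i < n)%N.
    by apply/allP/idP => [|lin j]; rewrite ?inE; [apply; rewrite inE|move/eqP->].
  have all2 : all (ltn^~ n) [fset 0%N; 1%N]%fset = (1 < n)%N.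
    apply/allP/idP => [|lin j]; first by apply; rewrite !inE.
    by rewrite !inE => /orP[]/eqP->//; exact: ltnW.
  rewrite !all1 all2; case: n {E0 all1 all2} => [|[|n]] /=;
    rewrite ?scaler0 ?addr0 ?walsh1//.
  by rewrite fE walsh2// addrA.
have s0 : supnorm (f - E_ lam 0 f) = a0 + 2 * a1.
  (* At the all-ones point every [u_ R j] equals 1, so the supremum is attained there. *)
  rewrite EE subr0; apply: (@supnorm_eq _ _ _ (fun=> true)) => [x|].
    rewrite two_levelE normc_real ler_norml; apply/andP.
    by case: (x 0%N); case: (x 1%N); split; lra.
  by rewrite two_levelE normc_real ger0_norm//; lra.
have s1 : supnorm (f - E_ lam 1 f) = 2 * a1.
  have dE x : (f - E_ lam 1 f) x =
      (if x 0%N then (if x 1%N then 2 * a1 else - (2 * a1)) else 0)%:C.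
    rewrite EE; change (f x - a0%:C * u_ R 0 x =
      (if x 0%N then (if x 1%N then 2 * a1 else - (2 * a1)) else 0)%:C).
    rewrite two_levelE u_E -rmorphM -rmorphB; congr (_%:C).
    by case: (x 0%N); case: (x 1%N); lra.
  apply: (@supnorm_eq _ _ _ (fun=> true)) => [x|].
    rewrite dE normc_real ler_norml; apply/andP.
    by case: (x 0%N); case: (x 1%N); split; lra.
  by rewrite dE normc_real ger0_norm//; lra.
have s2 n : supnorm (f - E_ lam n.+2 f) = 0.
  rewrite EE subrr; apply: (@supnorm_eq _ _ _ (fun=> true)) => [x|];
  by rewrite (normc_real 0) normr0.
apply/eqP; rewrite eq_le; apply/andP; split.
  (* The weights are 2 at level 0 and 4 at level 1; 8 a1 is below 2 a0 + 4 a1 because 2 a1 < a0. *)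
  apply: ge_ereal_sup => _ [[|[|n]] _ <-]; rewrite lee_fin invrK.
  - by rewrite s0 expr1; lra.
  - by rewrite s1 expr2; lra.
  - by rewrite s2 mul0r; lra.
apply: ereal_sup_ubound; exists 0%N => //.
by rewrite s0 invrK expr1 mulrC.
Qed.

End two_level.

Theorem theorem3p3 (R : realType) (lam : {scalar CC R})
    (hlam : is_product_state lam) :
  (forall (a0 a1 a2 : R) (f : CC R),
    f = a0%:C *: u_ R 0 + a1%:C *: u_ R 1 + a2%:C *: (u_ R 0 * u_ R 1) ->
    a0 > a1 + a2 -> a1 = a2 -> a2 > 0 ->
    [/\ Lip f = (Num.max (2 * (a0 + a1)) (8 * a1))%:E,
        Ltree lam f = (2 * (a0 + 2 * a1))%:E,
        2 * (a0 + 2 * a1) = 2 * (a0 + 2 * a2) &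
        (Lip f < Ltree lam f)%E]) /\
  (let g : CC R := 4 *: u_ R 0 + u_ R 1 + u_ R 0 * u_ R 1 in
    [/\ Lip g = 10%:E, (10%:E < 12%:E :> \bar R)%E & Ltree lam g = 12%:E]).
Proof.
have main a0 a1 (f : CC R) (fE : f = a0%:C *: u_ R 0 + a1%:C *: u_ R 1 +
      a1%:C *: (u_ R 0 * u_ R 1)) (a01 : a1 + a1 < a0) (a1_gt0 : 0 < a1) :=
  (Lip_two_level fE a01 a1_gt0, Ltree_two_level fE hlam a01 a1_gt0).
split=> [a0 a1 a2 f fE + a12|g].
  rewrite -a12 in fE * => a01 a1_gt0; rewrite !(main _ _ _ fE)//.
  (* Positivity of a1 handles 2 (a0 + a1), and 2 a1 < a0 handles 8 a1. *)
  by split=> //; rewrite lte_fin gt_max; apply/andP; split; lra.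
have gE : g =
    4%:C *: u_ R 0 + 1%:C *: u_ R 1 + 1%:C *: (u_ R 0 * u_ R 1).
  by rewrite !rmorph1 !scale1r rmorph_nat.
have lt24 : (1 + 1 : R) < 4 by lra.
rewrite !(main _ _ _ gE lt24 ltr01).
split; last by congr (_%:E); lra.
  by congr (_%:E); rewrite max_l; lra.
by rewrite lte_fin ltr_nat.
Qed.
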